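(* Let $n\ge 3$, and let $s$ and $t$ be any two permutations of $[n]$ (vertices of the oriented star graph $\overrightarrow{S_n}$ defined in the context). Starting from $c=s$ and repeatedly applying the routing rule described in the context (with any of the choices the rule permits), one reaches $t$ after at most \[ |X(s,t)| + \max\{6, y\} \] moves, where \[ y = 4\max\{|ULL(s,t)|, |URR(s,t)|\} + \chi(s,t) + 4. \] Each move of the rule traverses an arc of $\overrightarrow{S_n}$.
   Context: Permutations of $[n]$ are viewed as sequences $\pi(1)\cdots\pi(n)$ (value $\pi(i)$ in position $i$). The sign of a permutation is the parity of its number of inversions. Let $k=\lceil (n-1)/2\rceil+1$; positions $2,\dots,k$ form the left half and positions $k+1,\dots,n$ the right half. The oriented star graph $\overrightarrow{S_n}$ has vertex set all permutations of $[n]$, with an arc $\pi\to\pi'$ iff $\pi'$ is obtained from $\pi$ by exchanging the values in positions $1$ and $i$, where $i$ is in the left half if $\pi$ is even and in the right half if $\pi$ is odd. Definitions, for permutations $s,t$ of $[n]$: $L(s)=\{s(i):2\le i\le k\}$, $R(s)=\{s(i):k+1\le i\le n\}$ (left and right values). $S(s,t)=\{s(i): s(i)=t(i)\}$ (settled values), $U(s,t)=[n]\setminus S(s,t)$ (unsettled values). Partition $U(s,t)\setminus\{s(1),t(1)\}$ into $ULL(s,t)=U\cap L(s)\cap L(t)$, $URR(s,t)=U\cap R(s)\cap R(t)$, $ULR(s,t)=U\cap L(s)\cap R(t)$, $URL(s,t)=U\cap R(s)\cap L(t)$. Also $SL(s,t)=S(s,t)\cap L(t)$, $SR(s,t)=S(s,t)\cap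 R(t)$. The crossed values are $X(s,t)=ULR(s,t)\cup URL(s,t)$. The cycles of $s$ relative to $t$ are the cycles of the permutation $s\circ t^{-1}$ of $[n]$ (mapping a value $v$ to $s(t^{-1}(v))$). Such a cycle is alternating if it has size at least $2$ and its successive elements alternate between $L(s)$ and $R(s)$; $\chi(s,t)$ is the number of alternating cycles of $s$ relative to $t$. The $c$-index of a value is its position in $c$. Routing rule (current permutation $c\ne t$, target $t$; a move exchanges $c(1)$ with $c(i)$). If $c$ is even (so $i$ must be a left-half position), with $ULL=ULL(c,t)$, $URR=URR(c,t)$, $ULR=ULR(c,t)$, $SL=SL(c,t)$: Case 1: if $c(1)\in L(t)$, take $i=t^{-1}(c(1))$ (settling move). Case 2: if $c(1)\notin L(t)$ and $|ULL|+|URR|>0$: (2.1) if $ULL$ contains a value not in the cycle of $c\circ t^{-1}$ containing $c(1)$, take $i$ the $c$-index of such a value; (2.2) if all values of $ULL$ (nonempty) lie in the cycle containing $c(1)$, take $i$ the $c$-index of the value of $ULL$ met first when traversing this cycle backward from $c(1)$; (2.3) if $ULL=\emptyset$, take $i$ the $c$-index of any value of $SL$. Case 3: if $c(1)\in R(t)$ and $|ULL|+|URR|=0$: (3.1) if $|ULR|>0$, take $i$ the $c$-index of a value of $ULR$, chosen from an alternating cycle of $c$ relative to $t$ if possible; (3.2) if $|ULR|=0$, take $i$ the $c$-index of $t(1)$ if $t(1)$ is a left value of $c$, otherwise the $c$-index of a settled value in the left half of $c$. Case 4: if $c(1)=t(1)$ and $|ULL|+|URR|=0$, take $i$ the $c$-index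 of a value of $ULR$. If $c$ is odd, the same rule applies with the roles of left and right interchanged throughout (i.e. $L\leftrightarrow R$, $ULL\leftrightarrow URR$, $ULR\leftrightarrow URL$, $SL\leftrightarrow SR$, and $i$ a right-half position).
   Formalization: Case 2.3 can have no candidate (n=4, t=1234, c=3421: SR is empty), so the literal rule gets stuck. The formal rule then also permits exchanging with any value of c in the half in use (left if c is even, right if odd); where SL (resp. SR) is nonempty, nothing changes. *)

(* Defs.v *)
From mathcomp Require Import all_boot all_fingroup.
From mathcomp Require Import zify.

Set Implicit Arguments.
Unset Strict Implicit.
Unset Printing Implicit Defensive.

(* With n = m.+1, positions and values range over 'I_n = {0, .., n-1}: the     *)
(* position (or value) written j in the 1-based convention is j - 1 here, and  *)
(* s(1) is s ord0.                                                             *)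

Notation Left := false (only parsing).
Notation Right := true (only parsing).

Section OrientedStarGraph.

Variable m : nat.
Local Notation n := m.+1.
Implicit Types (s t c : 'S_n) (a b : bool) (i : 'I_n).

(* The 1-based number k = ceil((n-1)/2) + 1; uphalf is division by 2 rounded   *)
(* up.                                                                         *)
Definition split_position : nat := uphalf n.-1 + 1.

(* The 1-based conditions 2 <= j <= k and k+1 <= j <= n, for j = i.+1.         *)
Definition half b : {set 'I_n} :=
  if b == Left then [set i : 'I_n | 2 <= i.+1 <= split_position]
  else [set i : 'I_n | split_position + 1 <= i.+1 <= n].

(* Even permutations use the left half, odd ones the right half.               *)
Definition active s : bool := if odd_perm s then Right else Left.

(* Products of permutations compose left to right: (tperm ord0 i * s) j is     *)
(* s (tperm ord0 i j), so this swaps the values in positions 1 and i.          *)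
Definition exchange s i : 'S_n := (tperm ord0 i * s)%g.

Definition star_arc : rel 'S_n :=
  fun s s' => [exists i in half (active s), s' == exchange s i].

Definition vals b s : {set 'I_n} := [set s i | i in half b].

Definition settled s t : {set 'I_n} := [set s i | i : 'I_n & s i == t i].
Definition unsettled s t : {set 'I_n} := ~: settled s t.

(* U_ Left Left, U_ Right Right, U_ Left Right, U_ Right Left are the sets     *)
(* ULL, URR, ULR, URL, and S_ Left, S_ Right are SL, SR.                       *)
Definition U_ a b s t : {set 'I_n} := unsettled s t :&: vals a s :&: vals b t.
Definition S_ b s t : {set 'I_n} := settled s t :&: vals b t.

Definition crossed s t : {set 'I_n} := U_ Left Right s t :|: U_ Right Left s t.

(* The permutation s o t^-1 of the values (product order as above).            *)
Definition relp s t : 'S_n := (t^-1 * s)%g.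

Definition alternating s t (C : {set 'I_n}) : bool :=
  (2 <= #|C|) &&
  [forall v in C, (v \in vals Left s) && (relp s t v \in vals Right s)
               || (v \in vals Right s) && (relp s t v \in vals Left s)].

Definition alternating_cycles s t : {set {set 'I_n}} :=
  [set C in porbits (relp s t) | alternating s t C].

Definition chi s t : nat := #|alternating_cycles s t|.

(* The positions i that the routing rule permits at c, for c != t. The rule is *)
(* written for the half b of c used at this step and the other half b', so     *)
(* that b = Left (c even) is the rule as usually stated and b = Right (c odd)  *)
(* its left-right mirror image. The last branch is c(1) = t(1), since every    *)
(* value other than t(1) lies in vals Left t or in vals Right t.               *)
(*   When U_ b b is empty one exchanges with any value of S_ b, but S_ b can   *)
(* be empty too, e.g. for c = 3 4 2 1 and t = 1 2 3 4, and without a further   *)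
(* clause the rule would then permit nothing. Any value of the half in use is  *)
(* permitted in that situation. By S_near_neq0 below it never arises for n odd *)
(* nor for c even.                                                             *)
Definition permitted t c : {set 'I_n} :=
  let b := active c in
  let b' := ~~ b in
  let c1 := c ord0 in
  let cycle1 := porbit (relp c t) c1 in
  let index_of (A : {set 'I_n}) := c @^-1: A in
  let ULL := U_ b b c t in
  let URR := U_ b' b' c t in
  let ULR := U_ b b' c t in
  let SL := S_ b c t in
  if c1 \in vals b t then [set (t^-1)%g c1]
  else if 0 < #|ULL| + #|URR| then
    if ~~ (ULL \subset cycle1) then index_of (ULL :\: cycle1)
    else if ULL != set0 then
      let backward := traject (relp c t)^-1%g c1 n in
      index_of [set head c1 [seq v <- backward | v \in ULL]]
    else index_of (if SL != set0 then SL else vals b c)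
  else if c1 \in vals b' t then
    if 0 < #|ULR| then
      let ULRalt := ULR :&: cover (alternating_cycles c t) in
      index_of (if ULRalt != set0 then ULRalt else ULR)
    else if t ord0 \in vals b c then index_of [set t ord0]
    else index_of (settled c t :&: vals b c)
  else index_of ULR.

Definition routing_move t : rel 'S_n :=
  fun c c' => (c != t) && [exists i in permitted t c, c' == exchange c i].

Lemma card_half_le b : (b == Left) || odd n -> #|half (~~ b)| <= #|half b|.
Proof.
move=> hb; pose d (a : bool) i := if a then i + uphalf m else i - uphalf m.
pose f a i : 'I_n := inord (d a i).
have fE : {in half (~~ b), forall i, f b i = d b i :> nat /\ f b i \in half b}.
  move=> i; have := ltn_ord i; rewrite /f /d /half /split_position.
  by case: b hb => /= hb; rewrite !inE => ltim hi; rewrite inordK; lia.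
have f_inj : {in half (~~ b) &, injective (f b)}.
  move=> i j hi hj ij; apply: val_inj.
  have [ei _] := fE i hi; have [ej _] := fE j hj.
  move: hi hj ei ej; rewrite ij /d /half /split_position.
  by case: (b) => /=; rewrite !inE => hi hj ->; lia.
rewrite -(card_in_imset f_inj).
by apply/subset_leq_card/subsetP => _ /imsetP[i hi ->]; have [] := fE i hi.
Qed.

Lemma S_near_neq0 t c :
  let b := active c in
  ~~ odd_perm c || odd n ->
  c ord0 \notin vals b t -> 0 < #|U_ b b c t| + #|U_ (~~ b) (~~ b) c t| ->
  U_ b b c t = set0 -> S_ b c t != set0.
Proof.
move=> b hb c1 + Ub0; rewrite Ub0 cards0 add0n card_gt0 => /set0Pn[w].
have {}hb : (b == Left) || odd n by move: hb; rewrite /b /active; case: odd_perm.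
have cover_half a i : i != ord0 -> i \notin half a -> i \in half (~~ a).
  rewrite -val_eqE /half /split_position; have := ltn_ord i.
  by case: a; rewrite !inE /=; lia.
have half_disj a i : i \in half a -> i \notin half (~~ a).
  by rewrite /half /split_position; case: a; rewrite !inE /=; lia.
rewrite inE in_setI -andbA => /and3P[_ wc wt]; apply/negP => /eqP S0.
have sub : vals b t \subset vals (~~ b) c :\ w.
  apply/subsetP => v vt; rewrite in_setD1; apply/andP; split.
    apply/eqP => vw; move: vt wt; rewrite vw => /imsetP[i hi ->] /imsetP[j hj].
    by move/perm_inj => ij; move: (half_disj _ _ hi); rewrite ij hj.
  have vS : v \notin settled c t.
    by apply/negP => vS; move: (in_set0 v); rewrite -S0 inE vS vt.
  have vc : v \notin vals b c.
    apply/negP => vc; move: (in_set0 v).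
    by rewrite -Ub0 /U_ 2!inE vc vt in_setC vS.
  rewrite -[v](permKV c) in vc *; apply/imset_f/cover_half.
    by apply: contraNneq c1 => <-; rewrite permKV.
  by apply: contra vc => ?; apply: imset_f.
have := subset_leq_card sub; have := cardsD1 w (vals (~~ b) c).
rewrite wc !card_imset; try exact: perm_inj.
by have := card_half_le hb; lia.
Qed.

End OrientedStarGraph.

(* Main.v *)
Require Import Defs.
From mathcomp Require Import all_boot all_fingroup.
From mathcomp Require Import zify.

(* A value strictly decreasing along every permitted move is attached to each  *)
(* state. A move multiplies s o t^-1 by a transposition, so it merges the      *)
(* cycle of c(1) with another one or splits it, and a cycle is alternating     *)
(* exactly when all its values are crossed. Settling a crossed value costs one *)
(* move, entering an alternating cycle one more, and an uncrossed value costs  *)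
(* two: it is first exchanged to the other side, making some value crossed.    *)
(* Since the sides alternate, max(|ULL|, |URR|) governs the number of such     *)
(* exchanges. A split can create an alternating cycle only when it exhausts    *)
(* ULL or URR, or at the very end, which is what the additive constant covers. *)

(** [potential] starts within the claimed bound ([potential_bound]) and drops at every permitted
    move ([potential_move]), which bounds the length of any routing. By [permitted_neq0] routing can
    stop only at [t], and by [permitted_half] its moves are arcs.

    Write w for the value exchanged with c(1). Only these two values change position
    ([card_U_exchange]). The only alternating cycle that can appear is the new cycle of c(1), and
    only if w shared a cycle with c(1) before ([chi_exchange], [crossed_split_porbit]). In Case 2.2
    this forces w to be the only uncrossed value of the half in use ([first_backward]). Each branch
    of the rule then reduces to inequalities of section [Costs]. *)

Set Implicit Arguments.
Unset Strict Implicit.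
Unset Printing Implicit Defensive.

(* P and Q are the numbers of uncrossed unsettled values of the half in use    *)
(* and of the other half, x = |X|, k = chi; home, active and away say that     *)
(* c(1) is t(1), is a value of t in the half in use, or in the other half.     *)
(* From an away state, with sides alternating, rounds P Q moves exhaust both   *)
(* kinds; each makes one value crossed, hence costs 2.                         *)
Definition rounds P Q := maxn (2 * P).-1 (2 * Q).

(* The summand [0 < P] + [0 < Q] bounds the alternating cycles still to be     *)
(* created by Case 2.2, each of which exhausts one of the two kinds. The flag  *)
(* f, no value other than t(1) is settled, pays for the exceptional clause of  *)
(* [permitted] that is used when S_ is empty.                                  *)
Definition home_cost P Q x k (f : bool) : nat :=
  if P + Q == 0 then x + k else
  x + 2 * rounds P Q - 1
  + maxn (k + (if P + Q == 1 then 0 else (0 < P) + (0 < Q)) + 1) 3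
  + (3 <= rounds P Q) + 2 * (rounds P Q == 1) + [&& P == 0, Q == 1 & f].

Definition active_cost P Q x k : nat :=
  if P + Q == 0 then x + k + 1 else
  x + 4 * maxn P Q
  + maxn (k + (if P + Q == 1 then 0 else (0 < P) + (0 < Q)) + 1) 3
  + (2 <= maxn P Q).

(* The flag g says that the uncrossed values of the half in use lie in the     *)
(* cycle of c(1); otherwise Case 2.1 applies and creates no alternating cycle. *)
Definition away_cost P Q x k (g : bool) : nat :=
  if P + Q == 0 then x + (if x == 0 then 5 else maxn (k + 1) 3) else
  x + 2 * rounds P Q
  + maxn (k + (if (P == 1) && (Q == 0) then nat_of_bool g
               else (0 < P) + (0 < Q)) + 1) 3
  + (2 <= rounds P Q).

Ltac cost := rewrite /home_cost /active_cost /away_cost /rounds;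
  repeat match goal with |- context [if ?b then _ else _] =>
    let h := fresh in case h : b; move: h end; try lia.

(** * Arithmetic of the costs, by kind of move *)

Section Costs.
Variables P Q x k k' : nat.
Implicit Types f g : bool.

(** The conditions on P and Q only separate 0, 1 and larger values, so these cases leave linear
    arithmetic. *)
Lemma home_cost_bound f :
  home_cost P Q x k f <= x + maxn 6 (4 * maxn P Q + k + 4).
Proof. move: P Q => [|[|p]] [|[|q]]; cost. Qed.
Lemma active_cost_bound :
  active_cost P Q x k <= x + maxn 6 (4 * maxn P Q + k + 4).
Proof. move: P Q => [|[|p]] [|[|q]]; cost. Qed.
Lemma away_cost_bound g :
  away_cost P Q x k g <= x + maxn 6 (4 * maxn P Q + k + 4).
Proof. move: P Q => [|[|p]] [|[|q]]; cost. Qed.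

Lemma settle_crossed : k' <= k -> active_cost Q P x k' < active_cost P Q x.+1 k.
Proof. move: P Q => [|[|p]] [|[|q]]; cost. Qed.
Lemma settle_uncrossed g : k' <= k ->
  away_cost Q P x k' g < active_cost P.+1 Q x k.
Proof. move: P Q => [|[|p]] [|[|q]]; cost. Qed.
Lemma settle_home : k' <= k -> home_cost Q P x k' false < active_cost P Q x k.
Proof. move: P Q => [|[|p]] [|[|q]]; cost. Qed.

(** [rounds Q P] is one less than [rounds P.+1 Q], so 2 * [rounds] falls by 2 while x grows by 1. A
    new alternating cycle ([alt]) is paid for by the vanishing indicator of the active kind, or by
    [g] if nothing else is uncrossed. *)
Lemma away_uncrossed (alt g g' : bool) :
  k' <= k + alt -> (alt -> P = 0 /\ g) ->
  away_cost Q P x.+1 k' g' < away_cost P.+1 Q x k g.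
Proof.
by case: alt => + H; [case: H => // -> -> | move=> {H}];
  move: P Q => [|[|p]] [|[|q]]; cost.
Qed.
Lemma home_uncrossed f g : k' <= k ->
  away_cost Q P x k' g < home_cost P.+1 Q x k f.
Proof. move: P Q => [|[|p]] [|[|q]]; cost. Qed.

Lemma away_settled g g' : k' <= k ->
  away_cost Q.+1 0 x.+1 k' g' < away_cost 0 Q.+1 x k g.
Proof. move: P Q => [|[|p]] [|[|q]]; cost. Qed.
Lemma home_settled f g : k' <= k -> (Q = 0 -> ~~ g) ->
  away_cost Q.+1 0 x k' g < home_cost 0 Q.+1 x k f.
Proof. by case: Q => [le /(_ erefl) /negbTE ->|q le _]; cost. Qed.

Lemma away_fallback g : k' <= k.+1 ->
  active_cost 1 0 x k' < away_cost 0 1 x k g.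
Proof. cost. Qed.
Lemma away_fallback_home f g : k' <= k.+1 ->
  home_cost 1 0 x.+1 k' f < away_cost 0 1 x k g.
Proof. cost. Qed.
Lemma home_fallback : k' <= k ->
  active_cost 1 0 x k' < home_cost 0 1 x.+1 k true.
Proof. cost. Qed.

(** The floor 3 in [away_cost] covers one alternating cycle arising when there was none. *)
Lemma away_alternating g : k' < k \/ k = 0 /\ k' <= 1 ->
   0 < x -> active_cost 0 0 x k' < away_cost 0 0 x k g.
Proof. cost. Qed.
Lemma away_first f g : k' <= 1 -> home_cost 0 0 x.+1 k' f < away_cost 0 0 x 0 g.
Proof. cost. Qed.
(** The value 5 at x = 0 allows for this detour: one crossed value plus the floor 3 remain. *)
Lemma away_detour g g' : k' = 0 ->
  away_cost 0 0 1 k' g' < away_cost 0 0 0 0 g.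
Proof. cost. Qed.
Lemma home_alternating f : k' < k -> active_cost 0 0 x k' < home_cost 0 0 x.+1 k f.
Proof. cost. Qed.
End Costs.

Local Open Scope group_scope.
Local Open Scope nat_scope.

(** * Halves, values, cycles, and the criterion for alternation *)

Section Exchange.
Variable m : nat.
Local Notation n := m.+1.
Local Notation hpos := (@Defs.half m).
Implicit Types (s t c : 'S_n) (a b d : bool) (i v w : 'I_n).

Lemma in_halfN b i : (i \in hpos (~~ b)) = (i != ord0) && (i \notin hpos b).
Proof.
rewrite -val_eqE /Defs.half /split_position; have := ltn_ord i.
by case: b; rewrite !inE /=; lia.
Qed.

Lemma ord0_half b : ord0 \in hpos b = false.
Proof. by rewrite /Defs.half /split_position; case: b; rewrite !inE /=; lia. Qed.

Lemma half_neq0 b : 2 <= m -> hpos b != set0.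
Proof.
move=> m2; apply/set0Pn; exists (inord (if b then m else 1)).
by rewrite /Defs.half /split_position; case: b; rewrite !inE inordK; lia.
Qed.

Lemma card_halfN b : #|hpos (~~ b)| <= #|hpos b|.+1.
Proof.
case: b; last exact/leqW/card_half_le.
have -> : #|hpos true|.+1 = #|ord0 |: hpos true|.
  by rewrite cardsU1 ord0_half.
(* At most the last left position overflows under this shift; it is sent to position 0. *)
pose d i := if i + uphalf m <= m then i + uphalf m else 0.
pose f i : 'I_n := inord (d i).
have fE : {in hpos false, forall i, f i = d i :> nat}.
  by move=> i _; rewrite inordK // /d; case: ifP; lia.
have f_inj : {in hpos false &, injective f}.
  move=> i j hi hj ij; apply: val_inj.
  have := fE i hi; rewrite ij fE // /d; move: hi hj.
  rewrite /Defs.half /split_position !inE /=.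
  by do 2 case: ifP; lia.
rewrite -(card_in_imset f_inj); apply/subset_leq_card/subsetP => _ /imsetP[i hi ->].
rewrite in_setU1 -val_eqE /=; move: hi (fE i hi).
rewrite /Defs.half /split_position !inE /= => + ->; have := ltn_ord i.
by rewrite /d; case: ifP; lia.
Qed.

Lemma mem_vals b s v : (v \in vals b s) = (s^-1 v \in hpos b).
Proof.
apply/imsetP/idP => [[i hi ->]|hv]; first by rewrite permK.
by exists (s^-1 v); rewrite ?permKV.
Qed.

Lemma vals_ord0 b s : s ord0 \in vals b s = false.
Proof. by rewrite mem_vals permK ord0_half. Qed.

Lemma in_valsN b s v :
  (v \in vals (~~ b) s) = (v != s ord0) && (v \notin vals b s).
Proof. by rewrite !mem_vals in_halfN (can2_eq (permKV s) (permK s)). Qed.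

Lemma mem_settled s t v : (v \in settled s t) = (s^-1 v == t^-1 v).
Proof.
apply/imsetP/eqP => [[i]|e].
  by rewrite inE => /eqP e ->; rewrite permK e permK.
by exists (s^-1 v); rewrite ?permKV // inE permKV e permKV.
Qed.

Lemma mem_U a d s t v :
  (v \in U_ a d s t) =
  [&& s^-1 v != t^-1 v, v \in vals a s & v \in vals d t].
Proof. by rewrite /U_ /unsettled !inE mem_settled andbA. Qed.

Lemma mem_S b s t v :
  (v \in S_ b s t) = (s^-1 v == t^-1 v) && (v \in vals b t).
Proof. by rewrite /S_ inE mem_settled. Qed.

Lemma S_sub_vals b s t v : v \in S_ b s t -> v \in vals b s.
Proof. by rewrite mem_S !mem_vals => /andP[/eqP ->]. Qed.

(** A value in opposite halves of [s] and [t] cannot be settled. *)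
Lemma mem_UN b s t v :
  (v \in U_ b (~~ b) s t) = (v \in vals b s) && (v \in vals (~~ b) t).
Proof.
rewrite mem_U !mem_vals; case: eqP => //= ->.
by rewrite in_halfN; case: (_ \in hpos b); rewrite ?andbF.
Qed.

Lemma mem_NU b s t v :
  (v \in U_ (~~ b) b s t) = (v \in vals (~~ b) s) && (v \in vals b t).
Proof. by have := mem_UN (~~ b) s t v; rewrite negbK. Qed.

Lemma crossedE b s t :
  crossed s t = U_ b (~~ b) s t :|: U_ (~~ b) b s t.
Proof. by rewrite /crossed; case: b; rewrite // setUC. Qed.

Lemma card_crossed b s t :
  #|crossed s t| = (#|U_ b (~~ b) s t| + #|U_ (~~ b) b s t|)%N.
Proof.
rewrite (crossedE b); suff U0 : U_ b (~~ b) s t :&: U_ (~~ b) b s t = set0.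
  by rewrite -cardsUI -crossedE U0 cards0 addn0.
apply/setP => v; rewrite inE mem_UN mem_NU (in_valsN b s) in_set0.
by case: (v \in vals b s); rewrite /= ?andbF /= ?andbF.
Qed.

Lemma mem_crossed b s t v : (v \in crossed s t) =
  (v \in vals b s) && (v \in vals (~~ b) t)
  || (v \in vals (~~ b) s) && (v \in vals b t).
Proof. by rewrite (crossedE b) inE mem_UN mem_NU. Qed.

Lemma relpE s t v : relp s t v = s (t^-1 v).
Proof. by rewrite permM. Qed.

Lemma porbit_closed (f : 'S_n) (A : {set 'I_n}) v :
  v \in A -> {in A, forall u, f u \in A} -> porbit f v \subset A.
Proof.
move=> vA fA; apply/subsetP => _ /porbitP[j ->].
by elim: j => [|j IH]; rewrite ?perm1 // expgSr permM fA.
Qed.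

Lemma porbit_closed1 (f : 'S_n) x v : v \in porbit f x -> f v \in porbit f x.
Proof.
by rewrite -!eq_porbit_mem => /eqP <-; rewrite eq_porbit_mem (mem_porbit _ 1).
Qed.

(** The successor of v lies in the half of [s] that v occupies in [t], so alternation at v means
    that v is crossed. *)
Lemma alternating_crossed s t C : C \in porbits (relp s t) ->
  alternating s t C = (C \subset crossed s t).
Proof.
move=> /imsetP[x _ ->{C}]; set C := porbit _ x.
have relp_vals b v : (relp s t v \in vals b s) = (v \in vals b t).
  by rewrite !mem_vals relpE permK.
have E v : (v \in vals false s) && (relp s t v \in vals true s)
           || (v \in vals true s) && (relp s t v \in vals false s)
           = (v \in crossed s t).
  by rewrite (mem_crossed false) !relp_vals.
rewrite /alternating; apply/andP/subsetP => [[_ /forall_inP CP] v /CP|CP].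
  by rewrite E.
split; last by apply/forall_inP => v /CP; rewrite E.
have xC : x \in C by apply: porbit_id.
(* A crossed fixed point would lie in both halves of [s], so size at least 2 is automatic. *)
rewrite (cardsD1 x) xC add1n ltnS card_gt0; apply/set0Pn.
exists (relp s t x); rewrite !inE porbit_closed1 ?andbT //.
apply/eqP => e; have := CP x xC; rewrite -E e (in_valsN false) /=.
by case: (_ \in vals false s); rewrite ?andbF.
Qed.

Lemma mem_alternating_cycles s t C : (C \in alternating_cycles s t) =
  (C \in porbits (relp s t)) && (C \subset crossed s t).
Proof.
by rewrite inE; case: (boolP (C \in _)) => //= /alternating_crossed.
Qed.

Lemma mem_cover_alternating s t v :
  (v \in cover (alternating_cycles s t)) =
  (porbit (relp s t) v \subset crossed s t).
Proof.
apply/bigcupP/idP => [[C]|sub].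
  rewrite mem_alternating_cycles => /andP[/imsetP[x _ ->] sub].
  by rewrite -eq_porbit_mem => /eqP ->.
exists (porbit (relp s t) v); last exact: porbit_id.
by rewrite mem_alternating_cycles imset_f.
Qed.

Lemma exchangeV c i v : (exchange c i)^-1 v = tperm ord0 i (c^-1 v).
Proof. by rewrite /exchange invMg permM tpermV. Qed.

Lemma exchange_ord0 c i : exchange c i ord0 = c i.
Proof. by rewrite /exchange permM tpermL. Qed.

Lemma relp_exchange c t i :
  relp (exchange c i) t = (tperm (t ord0) (t i) * relp c t)%g.
Proof.
by rewrite -tpermJ /relp /exchange conjgE !mulgA mulgK.
Qed.

(** * Effect of one exchange on the counts and the cycles *)

Section Step.
Variables (t c : 'S_n) (b : bool) (i : 'I_n).
Hypothesis ib : i \in hpos b.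
Local Notation c' := (exchange c i).
Local Notation w := (c i).
Local Notation c1 := (c ord0).
Local Notation D := (porbit (relp c' t) c1).

Lemma half_neq_ord0 : i != ord0.
Proof. by apply: contraTneq ib => ->; rewrite ord0_half. Qed.

Lemma w_neq_c1 : w != c1.
Proof. by rewrite (inj_eq perm_inj) half_neq_ord0. Qed.

Lemma w_vals : w \in vals b c.
Proof. by rewrite mem_vals permK. Qed.

Lemma active_exchange : active c' = ~~ active c.
Proof.
rewrite /active /exchange odd_mul_tperm eq_sym half_neq_ord0 /=.
by case: (odd_perm c).
Qed.

Lemma exchangeV_c1 : c'^-1 c1 = i.
Proof. by rewrite exchangeV permK tpermL. Qed.

Lemma exchangeV_other v : v != c1 -> v != w -> c'^-1 v = c^-1 v.
Proof.
move=> v1 vw; rewrite exchangeV tpermD //.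
  by apply: contraNneq v1 => ->; rewrite permKV.
by apply: contraNneq vw => ->; rewrite permKV.
Qed.

Lemma vals_exchange a v : v \in vals a c' =
  if v == c1 then i \in hpos a else (v != w) && (v \in vals a c).
Proof.
case: eqP => [->|/eqP v1]; first by rewrite mem_vals exchangeV_c1.
case: (eqVneq v w) => [->|vw] /=.
  by rewrite -[w in LHS]exchange_ord0 vals_ord0.
by rewrite !mem_vals exchangeV_other.
Qed.

Lemma mem_U_exchange a d v : (v \in U_ a d c' t) =
  if v == c1 then [&& i != t^-1 c1, i \in hpos a & c1 \in vals d t]
  else (v != w) && (v \in U_ a d c t).
Proof.
rewrite !mem_U vals_exchange; case: (eqVneq v c1) => [->|v1].
  by rewrite exchangeV_c1.
case: (eqVneq v w) => [->|vw] /=; first by rewrite !andbF.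
by rewrite exchangeV_other.
Qed.

(** Correction terms are added on both sides to avoid truncated subtraction. *)
Lemma card_U_exchange a d :
  #|U_ a d c' t| + (w \in U_ a d c t) =
  #|U_ a d c t| + [&& i != t^-1 c1, i \in hpos a & c1 \in vals d t].
Proof.
rewrite (cardsD1 c1 (U_ a d c' t)) (cardsD1 w (U_ a d c t)) mem_U_exchange eqxx.
suff -> : U_ a d c' t :\ c1 = U_ a d c t :\ w.
  by rewrite addnAC [RHS]addnAC; congr (_ + _); rewrite addnC.
apply/setP => v; rewrite !in_setD1 mem_U_exchange; case: eqP => //= ->.
by rewrite mem_U vals_ord0 !andbF.
Qed.

Lemma crossed_exchange v : v != c1 ->
  (v \in crossed c' t) = (v != w) && (v \in crossed c t).
Proof.
move=> /negbTE v1.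
by rewrite !(crossedE false) !in_setU !mem_U_exchange v1 andb_orr.
Qed.

Lemma crossed_exchange_c1 : (c1 \in crossed c' t) = (c1 \in vals (~~ b) t).
Proof.
rewrite (mem_crossed b) !vals_exchange eqxx ib in_halfN ib /= andbF orbF //.
Qed.

Lemma crossed_exchange_w : w \in crossed c' t = false.
Proof. by rewrite crossed_exchange ?eqxx // w_neq_c1. Qed.

Lemma relp_exchange_other v :
  v != t ord0 -> v != t i -> relp c' t v = relp c t v.
Proof. by move=> v0 vi; rewrite relp_exchange permM tpermD // eq_sym. Qed.

Lemma relp_exchange_t0 : relp c' t (t ord0) = w.
Proof. by rewrite relpE permK exchange_ord0. Qed.

Lemma relp_exchange_ti : relp c' t (t i) = c1.
Proof. by rewrite relpE permK /exchange permM tpermR. Qed.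

(** Now in position 1, w is not crossed, so D avoids w and its predecessor [t ord0], but contains
    [t i], the predecessor of c(1). Lying in distinct cycles, these two were separated by the
    exchange. *)
Lemma crossed_split_porbit : D \subset crossed c' t -> w \in porbit (relp c t) c1.
Proof.
move=> Dsub.
have t0D : t ord0 \notin D.
  apply/negP => /porbit_closed1; rewrite relp_exchange_t0 => /(subsetP Dsub).
  by rewrite crossed_exchange_w.
have tiD : t i \in D.
  by rewrite porbit_sym -[X in X \in _]relp_exchange_ti porbit_closed1 ?porbit_id.
have ti0 : t ord0 != t i by rewrite (inj_eq perm_inj) eq_sym half_neq_ord0.
(* Counting cycles in both directions: the two values cannot lie in distinct cycles both before and
   after. *)
have t0ti : t ord0 \in porbit (relp c t) (t i).
  have := porbits_mul_tperm (relp c t) (t ord0) (t i).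
  have := porbits_mul_tperm (relp c' t) (t ord0) (t i).
  have e : (tperm (t ord0) (t i) * relp c' t)%g = relp c t.
    by rewrite relp_exchange mulgA tperm2 mul1g.
  rewrite /= e -relp_exchange ti0.
  have -> : t ord0 \notin porbit (relp c' t) (t i).
    by move: tiD t0D; rewrite -eq_porbit_mem => /eqP ->.
  by case: (t ord0 \in porbit (relp c t) (t i)) => //=; lia.
have <- : relp c t (t i) = w by rewrite relpE permK.
apply: porbit_closed1; rewrite porbit_sym.
have <- : relp c t (t ord0) = c1 by rewrite relpE permK.
exact: porbit_closed1.
Qed.

(* D is the only cycle of c' that can be alternating without being an          *)
(* alternating cycle of c.                                                     *)
Lemma chi_exchange :
  chi c' t + (w \in cover (alternating_cycles c t)) <=
  chi c t + (D \subset crossed c' t).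
Proof.
pose A := alternating_cycles c t :\ porbit (relp c t) w.
pose B := if D \subset crossed c' t then [set D] else set0.
have sub : alternating_cycles c' t \subset A :|: B.
  apply/subsetP => C; rewrite mem_alternating_cycles => /andP[/imsetP[x _ ->]].
  set E := porbit _ x => Esub; rewrite in_setU.
  case: (boolP (c1 \in E)) => c1E.
    have DE : D = E by apply/eqP; rewrite eq_porbit_mem.
    by rewrite /B DE Esub in_set1 eqxx orbT.
  (* A crossed cycle without c(1) also misses w, hence the predecessors of both, and is
     unchanged. *)
  have wE : w \notin E.
    by apply/negP => /(subsetP Esub); rewrite crossed_exchange_w.
  have t0E : t ord0 \notin E.
    by apply: contra wE => /porbit_closed1; rewrite relp_exchange_t0.
  have tiE : t i \notin E.
    by apply: contra c1E => /porbit_closed1; rewrite relp_exchange_ti.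
  have eqE : porbit (relp c t) x = E.
    have eq_on j : (relp c t ^+ j)%g x = (relp c' t ^+ j)%g x.
      elim: j => [|j IH]; first by rewrite !expg0.
      rewrite !expgSr [LHS]permM IH [RHS]permM relp_exchange_other //.
        by apply: contraNneq t0E => <-; apply: mem_porbit.
      by apply: contraNneq tiE => <-; apply: mem_porbit.
    by apply/setP => v; apply/porbitP/porbitP => -[j ->]; exists j.
  apply/orP; left; rewrite in_setD1 mem_alternating_cycles -eqE imset_f //=.
  rewrite eq_porbit_mem porbit_sym eqE wE /=.
  apply/subsetP => v vE; have := subsetP Esub v vE.
  rewrite crossed_exchange; first by case/andP.
  by apply: contraNneq c1E => <-.
have := leq_trans (subset_leq_card sub) (leq_card_setU _ _).
rewrite mem_cover_alternating /chi.
rewrite (cardsD1 (porbit (relp c t) w) (alternating_cycles c t)) -/A.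
rewrite mem_alternating_cycles imset_f //= /B.
move=> le; rewrite addnC -addnA leq_add2l; apply: leq_trans le _.
by rewrite leq_add2l; case: (D \subset _); rewrite ?cards1 ?cards0.
Qed.

End Step.
End Exchange.

Lemma head_filter (T : Type) (x0 : T) (p : pred T) (l : seq T) :
  head x0 (filter p l) = nth x0 l (find p l).
Proof. by elim: l => //= x l IH; case: (p x). Qed.

(** * The potential, and its decrease in each case of the rule *)

Section Potential.
Variable m : nat.
Local Notation n := m.+1.
Local Notation hpos := (@Defs.half m).
Variable t : 'S_n.
Implicit Types (c : 'S_n) (a b d : bool) (i v w : 'I_n).

Definition potential c : nat :=
  let b := active c in
  let P := #|U_ b b c t| in
  let Q := #|U_ (~~ b) (~~ b) c t| in
  let x := #|crossed c t| in
  if c ord0 \in vals b t then active_cost P Q x (chi c t)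
  else if c ord0 \in vals (~~ b) t then
    away_cost P Q x (chi c t) (U_ b b c t \subset porbit (relp c t) (c ord0))
  else home_cost P Q x (chi c t)
         ((S_ b c t == set0) && (S_ (~~ b) c t == set0)).

Lemma potential_bound c :
  potential c <= #|crossed c t|
    + maxn 6 (4 * maxn #|U_ Left Left c t| #|U_ Right Right c t| + chi c t + 4).
Proof.
rewrite /potential; set b := active c.
have -> : maxn #|U_ Left Left c t| #|U_ Right Right c t|
          = maxn #|U_ b b c t| #|U_ (~~ b) (~~ b) c t|.
  by case: (b); rewrite //= maxnC.
case: ifP => _; first exact: active_cost_bound.
by case: ifP => _; [exact: away_cost_bound | exact: home_cost_bound].
Qed.

Lemma vals_disj a v : v \in vals a t -> v \in vals (~~ a) t = false.
Proof. by move=> va; rewrite in_valsN va andbF. Qed.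

Lemma target_cases a v : [|| v \in vals a t, v \in vals (~~ a) t | v == t ord0].
Proof. by rewrite in_valsN; case: (v \in vals a t); case: eqP. Qed.

Section Move.
Variables (c : 'S_n) (i : 'I_n).
Local Notation b := (active c).
Hypothesis ib : i \in hpos b.
Local Notation c' := (exchange c i).
Local Notation w := (c i).
Local Notation c1 := (c ord0).
Local Notation P := #|U_ b b c t|.
Local Notation Q := #|U_ (~~ b) (~~ b) c t|.
Local Notation D := (porbit (relp c' t) c1).

(* Backward from c1 no value of U_ b b is met before w, so after the exchange  *)
(* every other such value of the cycle is on the part D cut off.               *)
Lemma first_backward :
    w = head c1 [seq v <- traject (relp c t)^-1 c1 n | v \in U_ b b c t] ->
    w \in U_ b b c t -> U_ b b c t \subset porbit (relp c t) c1 ->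
    D \subset crossed c' t ->
  U_ b b c t = [set w].
Proof.
set f := relp c t; set g := f^-1; set f' := relp c' t; set U := U_ b b c t.
rewrite head_filter; set j := find _ _ => we wU Uc1 Dsub.
have c1U : c1 \notin U by rewrite mem_U vals_ord0 andbF.
have jn : j < n.
  rewrite ltnNge; apply/negP => nj; move: wU.
  by rewrite we nth_default ?size_traject // (negbTE c1U).
move: we; rewrite nth_traject // => we.
have before k : k < j -> iter k g c1 \notin U.
  move=> kj; have := before_find c1 kj.
  by rewrite nth_traject ?(ltn_trans kj) // => ->.
have forth k : k <= j -> iter k f w = iter (j - k) g c1.
  elim: k => [|k IH] kj; first by rewrite subn0.
  by rewrite iterS IH 1?ltnW // -subnSK //= permKV.
have j0 : 0 < j.
  by rewrite lt0n; apply: contraNneq c1U => j0; move: wU; rewrite we j0.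
have f0 : f (t ord0) = c1 by rewrite relpE permK.
have fi : f (t i) = w by rewrite relpE permK.
(* The arc from w to [t ord0], the predecessor of c(1); the exchange closes it, as [t ord0] now
   leads to w. *)
pose A := [set v in traject f w j].
have inA k : k < j -> iter k f w \in A.
  by move=> kj; rewrite inE; apply/trajectP; exists k.
have subA : porbit f' w \subset A.
  apply: porbit_closed => [|v]; first exact: (inA 0).
  rewrite inE => /trajectP[k kj ->].
  have [->|v0] := eqVneq (iter k f w) (t ord0).
    by rewrite relp_exchange_t0; apply: (inA 0).
  have fkE := forth _ kj.
  (* [t i] precedes w, so on this arc it would put w fewer than j backward steps from c(1). *)
  have [vi|vi] := eqVneq (iter k f w) (t i).
    have : iter (j - k.+1) g c1 \notin U by apply: before; lia.
    by rewrite -fkE iterS vi fi wU.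
  rewrite relp_exchange_other // -iterS; apply: inA; rewrite ltn_neqAle kj andbT.
  apply: contra_neq v0 => kj'; apply: (@perm_inj _ f).
  by rewrite f0 -iterS forth // kj' subnn.
have sub_orbits : porbit f c1 \subset porbit f' w :|: D.
  apply: porbit_closed => [|v vU]; first by rewrite in_setU porbit_id orbT.
  have [->|v0] := eqVneq v (t ord0); first by rewrite f0 in_setU porbit_id orbT.
  have [->|vi] := eqVneq v (t i); first by rewrite fi in_setU porbit_id.
  have -> : f v = f' v by rewrite /f' relp_exchange_other.
  by move: vU; rewrite !in_setU => /orP[] /porbit_closed1 ->; rewrite ?orbT.
apply/eqP; rewrite eqEsubset sub1set wU andbT; apply/subsetP => u uU.
have := subsetP sub_orbits u (subsetP Uc1 u uU).
rewrite in_setU in_set1 => /orP[/(subsetP subA)|].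
  rewrite inE => /trajectP[[|k] kj ue]; first by rewrite ue.
  have := before (j - k.+1).
  by rewrite -forth ?(ltnW kj) // -[iter _ _ w]ue uU; lia.
move/(subsetP Dsub); rewrite crossed_exchange; last by apply: contraNneq c1U => <-.
move: uU; rewrite mem_U (mem_crossed b) !(in_valsN b) => /and3P[_ -> ->].
by rewrite !andbF.
Qed.

(** Vacuous outside Case 1, so the counts below serve all cases. *)
Hypothesis c1_settles : c1 \in vals b t -> i = t^-1 c1.

Lemma w_valsN : w \in vals (~~ b) c = false.
Proof. by rewrite in_valsN (w_vals c ib) andbF. Qed.

Lemma card_inactive : #|U_ (~~ b) (~~ b) c' t| = Q.
Proof.
have := card_U_exchange t c i (~~ b) (~~ b).
by rewrite mem_U w_valsN in_halfN ib /= !andbF /= ?andbF !addn0.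
Qed.

Lemma card_active : #|U_ b b c' t| + (w \in U_ b b c t) = P.
Proof.
rewrite card_U_exchange // ib /=; case: (boolP (_ \in _)) => [/c1_settles ->|_].
  by rewrite eqxx addn0.
by rewrite andbF addn0.
Qed.

Lemma card_crossed_exchange :
  #|crossed c' t| + (w \in vals (~~ b) t) = #|crossed c t| + (c1 \in vals (~~ b) t).
Proof.
rewrite !(card_crossed b).
have := card_U_exchange t c i b (~~ b); have := card_U_exchange t c i (~~ b) b.
rewrite mem_UN mem_NU w_valsN (w_vals c ib) ib in_halfN ib /= andbF /= ?andbF.
have -> : (i != t^-1 c1) && (c1 \in vals (~~ b) t) = (c1 \in vals (~~ b) t).
  case: (boolP (_ \in _)); rewrite ?andbF // mem_vals andbT => h.
  by apply: contraTneq h => <-; rewrite in_halfN ib andbF.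
by rewrite !addn0 => -> e; rewrite addnAC e addnAC.
Qed.

Lemma crossed_split_away : D \subset crossed c' t -> c1 \in vals (~~ b) t.
Proof.
by move/subsetP/(_ c1 (porbit_id _ _)); rewrite (crossed_exchange_c1 t c ib).
Qed.

Lemma potential_next : potential c' =
  let x := #|crossed c' t| in
  if w \in vals (~~ b) t then active_cost Q #|U_ b b c' t| x (chi c' t)
  else if w \in vals b t then
    away_cost Q #|U_ b b c' t| x (chi c' t)
      (U_ (~~ b) (~~ b) c' t \subset porbit (relp c' t) w)
  else home_cost Q #|U_ b b c' t| x (chi c' t)
         ((S_ (~~ b) c' t == set0) && (S_ b c' t == set0)).
Proof.
by rewrite /potential (active_exchange c ib) negbK exchange_ord0 card_inactive.
Qed.

Lemma chi_noncrossing : D \subset crossed c' t = false -> chi c' t <= chi c t.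
Proof.
move=> D0; have := chi_exchange t c ib; rewrite D0 addn0.
exact/leq_trans/leq_addr.
Qed.

Lemma chi_alternating : w \in cover (alternating_cycles c t) ->
  D \subset crossed c' t = false -> chi c' t < chi c t.
Proof. by move=> wA D0; have := chi_exchange t c ib; rewrite D0 wA addn0 addn1. Qed.

Lemma potential_settle : c1 \in vals b t -> potential c' < potential c.
Proof.
move=> c1b; have ei := c1_settles c1b.
have chile : chi c' t <= chi c t.
  by apply/chi_noncrossing/negP => /crossed_split_away; rewrite vals_disj.
have := card_active; have := card_crossed_exchange.
rewrite potential_next /potential c1b (vals_disj c1b) addn0 /=.
have [wN|wN] := boolP (w \in vals (~~ b) t).
  rewrite mem_U (_ : (w \in vals b t) = false) ?andbF; last first.
    by move: wN; rewrite in_valsN => /andP[_ /negbTE].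
  by rewrite addn1 addn0 => <- ->; apply: settle_crossed.
rewrite addn0 => ->.
have [wb|wb] := boolP (w \in vals b t); last first.
  rewrite mem_U (negbTE wb) !andbF addn0 => ->.
  rewrite [X in home_cost _ _ _ _ X](_ : _ = false); first exact: settle_home.
  apply/negbTE; rewrite negb_and; apply/orP; right; apply/set0Pn; exists c1.
  by rewrite mem_S c1b (exchangeV_c1 c i) ei eqxx.
rewrite mem_U (w_vals c ib) wb permK.
(* Position i of [t] holds c(1), so w was not settled there. *)
have -> : i != t^-1 w.
  apply: contraNneq (w_neq_c1 c ib) => iw.
  by apply/eqP/(@perm_inj _ t^-1); rewrite -iw -ei.
by rewrite addn1 => <-; apply: settle_uncrossed.
Qed.

(** Serves Cases 2.1 and 2.2: the last hypothesis is vacuous in the former, where cycles merge, and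
    comes from [first_backward] in the latter. *)
Lemma potential_uncrossed : c1 \notin vals b t -> w \in U_ b b c t ->
    (D \subset crossed c' t ->
      #|U_ b b c t| = 1 /\ U_ b b c t \subset porbit (relp c t) c1) ->
  potential c' < potential c.
Proof.
move=> c1b wU Dalt; have := card_active; have := card_crossed_exchange.
have wb : w \in vals b t by move: wU; rewrite mem_U => /and3P[].
rewrite potential_next /potential (negbTE c1b) wU wb (vals_disj wb) addn0 addn1 /=.
have chile := chi_exchange t c ib.
have [c1N|c1N] := boolP (c1 \in _); rewrite ?addn1 ?addn0 => -> PE.
  rewrite -PE; apply: (@away_uncrossed _ _ _ _ _ (D \subset crossed c' t)).
    exact: leq_trans (leq_addr _ _) chile.
  by move=> /Dalt[]; rewrite -PE => -[->].
rewrite -PE; apply/home_uncrossed/chi_noncrossing/negP => /crossed_split_away.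
by rewrite (negbTE c1N).
Qed.

Lemma porbit_settled v : v \in settled c t -> porbit (relp c t) v = [set v].
Proof.
rewrite mem_settled => /eqP e; apply/eqP.
rewrite eqEsubset sub1set porbit_id andbT.
apply: porbit_closed; first exact: set11.
by move=> u /set1P ->; rewrite relpE -e permKV set11.
Qed.

(** Case 2.3: a settled w is a fixed point of [relp c t], so cycles merge and none becomes
    alternating. *)
Lemma potential_unsettle : c1 \notin vals b t ->
    U_ b b c t = set0 -> 0 < Q -> w \in S_ b c t ->
  potential c' < potential c.
Proof.
move=> c1b U0 Q0 wS; have := card_active; have := card_crossed_exchange.
move: (wS); rewrite mem_S permK => /andP[/eqP wi wb].
have tiw : t i = w by rewrite {1}wi permKV.
have w1 := w_neq_c1 c ib.
have wset : w \in settled c t by rewrite mem_settled permK -wi.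
rewrite potential_next /potential (negbTE c1b) U0 in_set0 wb (vals_disj wb).
rewrite !addn0 cards0.
have := card_inactive; case: Q Q0 => // q _ QE.
have chile : chi c' t <= chi c t.
  apply/chi_noncrossing/negP => /(crossed_split_porbit ib).
  by rewrite porbit_sym porbit_settled // inE eq_sym (negbTE w1).
move=> + -> /=; have [c1N|c1N] := boolP (c1 \in _); rewrite ?addn1 ?addn0 => ->.
  exact: away_settled.
(* From home, c(1) and w were both fixed points and now form a 2-cycle, which misses the remaining
   uncrossed value. *)
apply: home_settled => // q0; apply/subsetPn.
have c1t : c1 = t ord0 by move: c1N; rewrite in_valsN c1b andbT negbK => /eqP.
have [u uU] : exists u, u \in U_ (~~ b) (~~ b) c' t.
  by apply/set0Pn; rewrite -card_gt0 QE.
exists u => //; apply: contraTN uU => uw.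
have : u \in [set w; c1].
  apply: subsetP uw; apply: porbit_closed => [|v]; first by rewrite !inE eqxx.
  rewrite !inE => /orP[] /eqP ->; last by rewrite c1t relp_exchange_t0 eqxx.
  by rewrite -tiw relp_exchange_ti eqxx orbT.
move=> /set2P[] ->; rewrite mem_U ?(vals_disj wb) ?andbF //.
by rewrite c1t vals_ord0 !andbF.
Qed.

(* The half in use has at most one position less than the other, which must    *)
(* then hold all of [vals b t].                                                *)
Lemma fallback_counts :
    c1 \notin vals b t -> U_ b b c t = set0 -> S_ b c t = set0 -> 0 < Q ->
  Q = 1 /\ S_ (~~ b) c t = set0.
Proof.
move=> c1b U0 S0 Q0.
have half_le : #|vals (~~ b) c| <= #|vals b t|.+1.
  by rewrite !card_imset; [exact: card_halfN | exact: perm_inj ..].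
have UE : U_ (~~ b) b c t = vals b t.
  apply/setP => v; rewrite mem_NU.
  case: (boolP (v \in vals b t)) => vt; rewrite ?andbF // andbT.
  rewrite in_valsN; apply/andP; split; first by apply: contraTneq vt => ->.
  have vS : c^-1 v != t^-1 v.
    by apply/negP => vS; move: (in_set0 v); rewrite -S0 mem_S vS vt.
  by apply/negP => vc; move: (in_set0 v); rewrite -U0 mem_U vS vc vt.
(* [A] and [vals b t] are disjoint inside [vals (~~ b) c], which has at most one more element than
   [vals b t]. *)
pose A := U_ (~~ b) (~~ b) c t :|: S_ (~~ b) c t.
have dA : #|A| = Q + #|S_ (~~ b) c t|.
  rewrite -cardsUI [_ :&: _](_ : _ = set0) ?cards0 ?addn0 //.
  apply/setP => v; rewrite in_setI mem_U mem_S in_set0.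
  by case: eqP => _ /=; rewrite ?andbF.
have sub : A :|: vals b t \subset vals (~~ b) c.
  apply/subsetP => v; rewrite -UE !in_setU mem_U mem_NU.
  by case/orP=> [/orP[/and3P[]|/S_sub_vals]|/andP[]].
have dAB : #|A :|: vals b t| = #|A| + #|vals b t|.
  rewrite -cardsUI [_ :&: _](_ : _ = set0) ?cards0 ?addn0 //.
  apply/setP => v; rewrite in_setI in_setU mem_U mem_S in_set0 (in_valsN b t).
  by case: (v \in vals b t); rewrite ?andbF.
have := leq_trans (subset_leq_card sub) half_le.
rewrite dAB dA -[X in _ <= X]add1n leq_add2r => le1.
have Q1 : Q = 1 by lia.
by split=> //; apply/eqP; rewrite -cards_eq0; lia.
Qed.

Lemma potential_fallback :
    c1 \notin vals b t -> U_ b b c t = set0 -> S_ b c t = set0 -> 0 < Q ->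
  potential c' < potential c.
Proof.
move=> c1b U0 S0 Q0; have := card_active; have := card_crossed_exchange.
have [Q1 SN0] := fallback_counts c1b U0 S0 Q0.
rewrite potential_next /potential (negbTE c1b) U0 S0 SN0 in_set0 cards0 Q1.
rewrite addn0 eqxx /=.
have wb : w \in vals b t = false.
  apply/negP => wb; move: (in_set0 w).
  case: (eqVneq i (t^-1 w)) => ei; last first.
    by rewrite -U0 mem_U permK ei wb (w_vals c ib).
  by rewrite -S0 mem_S permK {1}ei eqxx wb.
have chile := chi_exchange t c ib.
have chile1 : chi c' t <= (chi c t).+1.
  apply: leq_trans (leq_addr _ _) (leq_trans chile _).
  by rewrite -[(chi c t).+1]addn1 leq_add2l leq_b1.
rewrite wb => + ->.
have [c1N|c1N] := boolP (c1 \in _); have [wN|wN] := boolP (w \in _);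
  rewrite ?addn1 ?addn0 => E.
- by rewrite -(succn_inj E); apply: away_fallback.
- by rewrite E; apply: away_fallback_home.
- rewrite -E; apply/home_fallback/chi_noncrossing/negP => /crossed_split_away.
  by rewrite (negbTE c1N).
have := target_cases b w; have := target_cases b c1.
rewrite wb (negbTE wN) (negbTE c1b) (negbTE c1N) /= => /eqP c1t /eqP wt.
by have := w_neq_c1 c ib; rewrite c1t wt eqxx.
Qed.

(** * States without uncrossed values: Cases 3 and 4, and moves inside alternating cycles *)

Section OnlyCrossed.
Hypothesis c1b : c1 \notin vals b t.
Hypothesis U0 : U_ b b c t = set0.
Hypothesis UN0 : U_ (~~ b) (~~ b) c t = set0.

Lemma card_active0 : #|U_ b b c' t| = 0.
Proof. by have := card_active; rewrite U0 in_set0 cards0 addn0. Qed.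

(** A cycle avoiding c(1) avoids its predecessor [t ord0]; being crossed, v is no fixed point, and
    all values of its cycle are then crossed. *)
Lemma cover_crossing v : v \in vals (~~ b) t -> v \notin porbit (relp c t) c1 ->
  v \in vals b c -> v \in cover (alternating_cycles c t).
Proof.
move=> vN vc1 vb; rewrite mem_cover_alternating; apply/subsetP => u uv.
have uc1 : u != c1 by apply: contraNneq vc1 => <-; rewrite porbit_sym.
have ut0 : u != t ord0.
  apply: contraNneq vc1 => u0; have := porbit_closed1 uv.
  by rewrite u0 relpE permK porbit_sym.
have uS : c^-1 u != t^-1 u.
  apply/eqP => e; have := uv; rewrite porbit_sym porbit_settled ?mem_settled ?e //.
  rewrite inE => /eqP uv'; move: vN; rewrite uv' mem_vals -e -mem_vals in_valsN.
  by rewrite -uv' vb andbF.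
have /negP := negbT (in_set0 u); rewrite -{1}U0 => /negP.
have /negP := negbT (in_set0 u); rewrite -{1}UN0 => /negP.
rewrite (mem_crossed b) !mem_U uS !(in_valsN b) uc1 ut0 /=.
by case: (u \in vals b c); case: (u \in vals b t).
Qed.

(** Successive values of an alternating cycle lie in opposite halves, so x or its image is in the
    half in use. *)
Lemma chi_gt0 : 0 < chi c t ->
  exists2 v, v \in U_ b (~~ b) c t & v \in cover (alternating_cycles c t).
Proof.
rewrite card_gt0 => /set0Pn[C CA]; have := CA.
rewrite mem_alternating_cycles => /andP[/imsetP[x _ ->{C CA}] sub].
have [xU|xU] := boolP (x \in U_ b (~~ b) c t).
  by exists x => //; rewrite mem_cover_alternating.
have yx : relp c t x \in porbit (relp c t) x by rewrite (mem_porbit _ 1).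
exists (relp c t x).
  have := subsetP sub _ yx; have := subsetP sub _ (porbit_id _ _).
  move: xU; rewrite !(crossedE b) !in_setU !mem_UN !mem_NU => /negbTE -> /=.
  rewrite !(in_valsN b) => /andP[_ xt].
  rewrite (_ : relp c t x \in vals b c).
    by case: (relp c t x \in vals b t); rewrite ?andbF ?andbT ?orbF.
  by rewrite mem_vals relpE permK -mem_vals.
rewrite mem_cover_alternating.
by move: yx; rewrite -eq_porbit_mem => /eqP ->.
Qed.

Lemma potential_cross : c1 \in vals (~~ b) t -> w \in U_ b (~~ b) c t ->
    w \in cover (alternating_cycles c t) \/ chi c t = 0 ->
  potential c' < potential c.
Proof.
move=> c1N wU wA; move: (wU); rewrite mem_UN (w_vals c ib) /= => wN.
have := card_crossed_exchange.
rewrite potential_next /potential (negbTE c1b) c1N wN U0 UN0 cards0 card_active0.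
move/addIn ->.
apply: away_alternating; last first.
  by rewrite card_gt0; apply/set0Pn; exists w; rewrite (crossedE b) inE wU.
have le := chi_exchange t c ib.
case: wA => [wA|k0]; [left|right]; move: le.
  (* c(1) is never crossed, so the alternating cycle of w is a different one and the move merges the
     two. *)
  have -> : D \subset crossed c' t = false.
    apply/negP => /(crossed_split_porbit ib); move: wA.
    rewrite mem_cover_alternating -eq_porbit_mem.
    move=> sub /eqP e; have := subsetP sub c1; rewrite e porbit_id => /(_ isT).
    by rewrite (mem_crossed b) !vals_ord0.
  by rewrite wA addn0 addn1.
rewrite k0 add0n => le; split=> //.
exact: leq_trans (leq_addr _ _) (leq_trans le (leq_b1 _)).
Qed.

Lemma potential_first :
    c1 \in vals (~~ b) t -> U_ b (~~ b) c t = set0 -> w = t ord0 ->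
  potential c' < potential c.
Proof.
move=> c1N UX w0; have := card_crossed_exchange.
have k0 : chi c t = 0.
  by apply/eqP; apply: contraT; rewrite -lt0n => /chi_gt0[v]; rewrite UX inE.
rewrite potential_next /potential (negbTE c1b) c1N w0 !vals_ord0 U0 UN0 cards0.
rewrite card_active0.
rewrite addn0 addn1 k0 => ->; apply: away_first.
have := chi_exchange t c ib; rewrite k0 add0n => le.
exact: leq_trans (leq_addr _ _) (leq_trans le (leq_b1 _)).
Qed.

(** Both permutations have the same values in the half in use, so nothing is crossed yet. *)
Lemma potential_detour : c1 \in vals (~~ b) t -> U_ b (~~ b) c t = set0 ->
    t ord0 \notin vals b c -> w \in settled c t ->
  potential c' < potential c.
Proof.
move=> c1N UX t0 wS; have := card_crossed_exchange.
have k0 : chi c t = 0.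
  by apply/eqP; apply: contraT; rewrite -lt0n => /chi_gt0[v]; rewrite UX inE.
have sub : vals b c \subset vals b t.
  apply/subsetP => v vc; apply: contraT => vt.
  have : v \in vals (~~ b) t.
    by rewrite in_valsN vt andbT; apply: contraNneq t0 => <-.
  by move=> vN; have := in_set0 v; rewrite -UX mem_UN vc vN.
have eqv : vals b c = vals b t.
  apply/eqP; rewrite eqEcard sub /= !card_imset //; exact: perm_inj.
have wb : w \in vals b t by rewrite -eqv (w_vals c ib).
have x0 : #|crossed c t| = 0.
  apply/eqP; rewrite cards_eq0 (crossedE b) UX set0U -subset0; apply/subsetP => v.
  by rewrite mem_NU (in_valsN b) eqv; case: (v \in vals b t); rewrite ?andbF.
rewrite potential_next /potential (negbTE c1b) c1N wb (vals_disj wb) U0 UN0.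
rewrite cards0 card_active0 x0 k0 addn0 => ->; apply: away_detour.
apply/eqP; rewrite -leqn0 -k0; apply/chi_noncrossing/negP => /(crossed_split_porbit ib).
by rewrite porbit_sym porbit_settled // inE eq_sym (negbTE (w_neq_c1 c ib)).
Qed.

(** c(1) is a cycle by itself; that of w is alternating by [cover_crossing] and is absorbed. *)
Lemma potential_leave : c1 \notin vals (~~ b) t -> w \in U_ b (~~ b) c t ->
  potential c' < potential c.
Proof.
move=> c1N wU; move: (wU); rewrite mem_UN (w_vals c ib) /= => wN.
have c1t : c1 = t ord0.
  by have := target_cases b c1; rewrite (negbTE c1b) (negbTE c1N) => /eqP.
have := card_crossed_exchange.
rewrite potential_next /potential (negbTE c1b) (negbTE c1N) wN U0 UN0 cards0.
rewrite card_active0 addn0 addn1 => <-; apply: home_alternating.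
apply: chi_alternating; last by apply/negP => /crossed_split_away; rewrite (negbTE c1N).
apply: cover_crossing => //; last exact: w_vals.
rewrite porbit_settled; first by rewrite inE (w_neq_c1 c ib).
by rewrite mem_settled permK c1t permK.
Qed.

End OnlyCrossed.
End Move.

(** * Permitted moves: legality, existence, decrease *)

Lemma first_backward_mem c :
    let b := active c in let c1 := c ord0 in
    U_ b b c t != set0 -> U_ b b c t \subset porbit (relp c t) c1 ->
  head c1 [seq v <- traject (relp c t)^-1 c1 n | v \in U_ b b c t] \in U_ b b c t.
Proof.
move=> b c1 /set0Pn[u uU] sub; rewrite head_filter; apply: nth_find.
apply/hasP; exists u => //; have := subsetP sub u uU.
rewrite -porbitV porbit_traject => /trajectP[k kn ->]; apply/trajectP.
by exists k => //; rewrite (leq_trans kn) // -[X in _ <= X](card_ord n) max_card.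
Qed.

Lemma permitted_half c : permitted t c \subset hpos (active c).
Proof.
apply/subsetP => i; rewrite /permitted; set b := active c.
have of_vals : c i \in vals b c -> i \in hpos b by rewrite mem_vals permK.
case: ifP => [c1b|_]; first by rewrite inE => /eqP ->; rewrite -mem_vals.
have of_U d : c i \in U_ b d c t -> i \in hpos b.
  by rewrite mem_U => /and3P[_ /of_vals].
case: ifP => _.
  case: ifP => [_|/negbFE sub].
    by rewrite inE => /setDP[/of_U].
  case: ifP => [U0|_].
    rewrite inE => /set1P ci; apply: (of_U b); rewrite ci.
    exact: first_backward_mem.
  by case: ifP => _; rewrite inE; [move/S_sub_vals/of_vals | move/of_vals].
case: ifP => _; last by rewrite inE => /of_U.
case: ifP => _.
  by case: ifP => _; rewrite inE; [case/setIP=> /of_U | move/of_U].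
by case: ifP => [t0|_]; rewrite inE; [move/set1P=> ci; apply: of_vals; rewrite ci
  | case/setIP=> _ /of_vals].
Qed.

Lemma preim_neq0 c (A : {set 'I_n}) : A != set0 -> c @^-1: A != set0.
Proof.
by move=> /set0Pn[v vA]; apply/set0Pn; exists (c^-1 v); rewrite inE permKV.
Qed.

(** With nothing uncrossed and no candidate to cross, the half in use is settled up to [t ord0]. In
    the last branch c(1) is [t ord0], so the other half is settled too and [c = t]. *)
Lemma permitted_neq0 c : 2 <= m -> c != t -> permitted t c != set0.
Proof.
move=> m2 ct; rewrite /permitted; set b := active c.
have vals0 : vals b c != set0.
  have /set0Pn[i ib] := half_neq0 b m2; apply/set0Pn; exists (c i).
  by rewrite mem_vals permK.
case: ifP => [_|c1b]; first by apply/set0Pn; exists (t^-1 (c ord0)); rewrite inE.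
case: ifP => [_|].
  case: ifP => [sub|_].
    by apply: preim_neq0; move: sub; rewrite -setD_eq0.
  case: ifP => _.
    by apply: preim_neq0; rewrite -card_gt0 cards1.
  by case: ifP => ?; apply: preim_neq0.
move/negbT; rewrite lt0n addn_eq0 negbK !cards_eq0 => /andP[/eqP U0 /eqP UN0].
case: ifP => [c1N|c1N].
  case: ifP => [U_gt0|/negbT].
    by case: ifP => ?; apply: preim_neq0; rewrite // -card_gt0.
  rewrite -leqNgt leqn0 cards_eq0 => /eqP UX0.
  case: ifP => [_|t0]; first by apply: preim_neq0; rewrite -card_gt0 cards1.
  apply: preim_neq0; have /set0Pn[v vc] := vals0; apply/set0Pn; exists v.
  rewrite inE vc andbT mem_settled; apply/negPn/negP => vS.
  have /or3P[vb|vN|/eqP v0] := target_cases b v.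
  - by have := in_set0 v; rewrite -U0 mem_U vS vc vb.
  - by have := in_set0 v; rewrite -UX0 mem_UN vc vN.
  by move: vc; rewrite v0 t0.
have c1t : c ord0 = t ord0.
  by have /or3P[|| /eqP] := target_cases b (c ord0); rewrite ?c1b ?c1N.
apply: preim_neq0; apply: contra_neq ct => UX0.
have vb_settled v : v \in vals b c -> c^-1 v = t^-1 v.
  move=> vc; apply/eqP/negPn/negP => vS.
  have /or3P[vb|vN|/eqP v0] := target_cases b v.
  - by have := in_set0 v; rewrite -U0 mem_U vS vc vb.
  - by have := in_set0 v; rewrite -UX0 mem_UN vc vN.
  by move: vc; rewrite v0 -c1t vals_ord0.
have cb i : i \in hpos b -> c i = t i.
  move=> ib; have := vb_settled (c i); rewrite mem_vals permK => /(_ ib) e.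
  by rewrite {2}e permKV.
apply/permP => i; have [->//|i0] := eqVneq i ord0.
have [ib|ib] := boolP (i \in hpos b); first exact: cb.
have iN : i \in hpos (~~ b) by rewrite in_halfN i0.
have vcN : c i \in vals (~~ b) c by rewrite mem_vals permK.
apply/(@perm_inj _ t^-1); rewrite permK; apply/eqP; rewrite eq_sym -{1}[i](permK c).
apply/negPn/negP => vS; have /or3P[vb|vN|/eqP v0] := target_cases b (c i).
- move: vb; rewrite mem_vals => vb; have := cb _ vb; rewrite permKV => /perm_inj e.
  by move: iN; rewrite -e in_halfN vb andbF.
- by have := in_set0 (c i); rewrite -UN0 mem_U vS vcN vN.
by move: v0; rewrite -c1t => /perm_inj /eqP; rewrite (negbTE i0).
Qed.

Lemma potential_move c c' : routing_move t c c' -> potential c' < potential c.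
Proof.
case/andP=> _ /exists_inP[i ip /eqP ->].
have ib : i \in hpos (active c) by apply: subsetP ip; apply: permitted_half.
move: ip; rewrite /permitted; set b := active c in ib *.
have [c1b|c1b] := boolP (c ord0 \in vals b t).
  by rewrite inE => /eqP ei; apply: potential_settle.
have c1_settles : c ord0 \in vals b t -> i = t^-1 (c ord0).
  by move=> h; case/negP: c1b.
have [PQ|] := ifPn.
  have [sub|/negPn sub] := ifPn.
    rewrite inE => /setDP[wU wC]; apply: potential_uncrossed => //.
    by move/(crossed_split_porbit ib) => wC'; case/negP: wC.
  have [U0|/negPn/eqP U0] := ifPn.
    rewrite inE => /set1P we.
    have wU : c i \in U_ b b c t by rewrite we; apply: first_backward_mem.
    apply: potential_uncrossed => // Dsub; split => //.
    by rewrite (first_backward ib we wU sub Dsub) cards1.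
  have Q0 : 0 < #|U_ (~~ b) (~~ b) c t| by move: PQ; rewrite U0 cards0.
  have [S0|/negPn/eqP S0 _] := ifPn; last exact: potential_fallback.
  by rewrite inE => wS; apply: potential_unsettle.
rewrite lt0n addn_eq0 negbK !cards_eq0 => /andP[/eqP U0 /eqP UN0].
have [c1N|c1N] := ifPn; last by rewrite inE => wU; apply: potential_leave.
have [UX0|] := ifPn.
  have [A0|/negPn/eqP A0] := ifPn; rewrite inE.
    by case/setIP=> wU wA; apply: potential_cross => //; left.
  move=> wU; apply: potential_cross => //; right.
  (* If no candidate lies in an alternating cycle, there is no such cycle. *)
  apply/eqP; apply: contraT; rewrite -lt0n => /chi_gt0[v vU vA].
  by have := in_set0 v; rewrite -A0 inE vU vA.
rewrite -leqNgt leqn0 cards_eq0 => /eqP UX0.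
have [t0|t0] := ifPn; rewrite inE.
  by move/set1P => w0; apply: potential_first.
by case/setIP=> wS _; apply: potential_detour.
Qed.

End Potential.

Theorem theorem2 (m : nat) (n_ge3 : 3 <= m.+1) (s t : 'S_m.+1) :
  (forall p : seq 'S_m.+1, path (routing_move t) s p ->
     size p <= #|crossed s t|
               + maxn 6 (4 * maxn #|U_ Left Left s t| #|U_ Right Right s t|
                         + chi s t + 4)
     /\ (last s p = t \/ exists c : 'S_m.+1, routing_move t (last s p) c))
  /\ (forall c c' : 'S_m.+1, routing_move t c c' -> star_arc c c').
Proof.
split=> [p sp|c c' /andP[_ /exists_inP[i ip /eqP ->]]]; last first.
  by apply/exists_inP; exists i => //; apply: subsetP ip; apply: permitted_half.
split.
  apply: leq_trans (potential_bound t s).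
  elim: p s sp => //= c p IH s /andP[/potential_move lt_c /IH le_p].
  exact: leq_ltn_trans lt_c.
have [->|ct] := eqVneq (last s p) t; [by left | right].
have /set0Pn[i ip] := permitted_neq0 n_ge3 ct.
exists (exchange (last s p) i); rewrite /routing_move ct.
by apply/exists_inP; exists i.
Qed.
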